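(* Let $p\ge 2$, let $X\subset\mathbb{R}^{p-1}$ be compact and equal to the closure of its interior, let $Y\subset\mathbb{R}$ be compact, and let $f:X\to Y$ be measurable. Let $\mu$, $\mu_0$, $m$, $m_0$, $\delta_0$ and $q_{\mu+\beta\mu_0,d}$ be as in the context, let $\alpha\in[0,1)$ and $\beta_d:=2^{3-\sqrt d}$. Let $(q^\alpha_d)_{d}$ be a sequence of continuous functions on $\mathbb{R}^p$ such that for every $d$ and every $\mathbf{z}\in\mathbb{R}^p$, $$\left|1-\frac{q^\alpha_d(\mathbf{z})}{q_{\mu+\beta_d\mu_0,d}(\mathbf{z})}\right|\le\alpha.$$ Let $r\in\mathbb{N}$ with $r>p$, and for $d\in\mathbb{N}$ define $$\gamma_d:=\frac{1-\alpha}{8(m+m_0)}\,\frac{e^{2r}d^r}{(3r)^{2r}},\qquad S_d:=\{\mathbf{z}\in\mathbb{R}^p: q^\alpha_d(\mathbf{z})<\gamma_d\}.$$ Then for every integer $d>1$: (i) $$\mu(\{\mathbf{z}\in\mathbb{R}^p:\mathbf{z}\notin S_d\})\le\frac{1+\alpha}{1-\alpha}\,\frac{8(m+m_0)(3r)^{2r}e^{p^2/d}}{p^p\,e^{2r-p}\,d^{\,r-p}}.$$ (ii) For any $\mathbf{z}\in S_d$, $$\mathrm{dist}(\mathbf{z},\mathrm{supp}(\mu))\le\frac{\delta_0}{\sqrt d-1}.$$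
   Context: $\mu$ is the Borel measure on $\mathbb{R}^p$ supported on the graph of $f$, $d\mu(\mathbf{x},y)=\mathbb{I}_X(\mathbf{x})\,d\mathbf{x}\,\delta_{f(\mathbf{x})}(dy)$, i.e. $\mu(A)=\mathrm{vol}(\{\mathbf{x}\in X:(\mathbf{x},f(\mathbf{x}))\in A\})$. Write $\mathbf{z}=(\mathbf{x},y)\in\mathbb{R}^p$ and $n_d=\binom{p+d}{d}$. The reference measure $\mu_0$ is a positive Borel measure on $\mathbb{R}^p$, absolutely continuous with respect to Lebesgue measure, with compact support. For each $d$, $\mathbf{b}=(b_1,\dots,b_{n_d})^\top$ is a vector of polynomials in $\mathbf{z}$ of total degree at most $d$ that is orthonormal for $\mu_0$: $\int b_ib_j\,d\mu_0=1$ if $i=j$ and $0$ otherwise. The moment matrix is $\mathbf{M}_{\mu,d}=\int \mathbf{b}(\mathbf{z})\mathbf{b}(\mathbf{z})^\top d\mu(\mathbf{z})$. For $\beta>0$ the regularized Christoffel-Darboux polynomial is $$q_{\mu+\beta\mu_0,d}(\mathbf{z})=\mathbf{b}(\mathbf{z})^\top(\mathbf{M}_{\mu,d}+\beta \mathbf{I}_{n_d})^{-1}\mathbf{b}(\mathbf{z}).$$ Constants: $\delta_0:=\mathrm{diam}(\mathrm{supp}(\mu+\mu_0))$, $m:=\mu(\mathbb{R}^p)$, $m_0:=\mu_0(\mathbb{R}^p)$. The support of a positive Borel measure is the smallest closed set whose complement has measure zero; $\mathrm{vol}$ is Lebesgue measure; $\mathrm{diam}$ and $\mathrm{dist}$ are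 Euclidean diameter and distance. *)

(* Defs.v *)
From HB Require Import structures.
From mathcomp Require Import all_boot all_order all_algebra.
From mathcomp Require Import all_classical all_reals all_analysis.
From mathcomp Require Import measurable_realfun.
From mathcomp Require mpoly.
Set Implicit Arguments.
Unset Strict Implicit.
Unset Printing Implicit Defensive.
Import Order.TTheory GRing.Theory Num.Theory.
Import numFieldNormedType.Exports.

Local Open Scope classical_set_scope.
Local Open Scope ring_scope.

(* Borel sigma-algebra of the (sup norm = Euclidean) topology of ['rV_n] *)
HB.instance Definition _ (R : realType) (n : nat) :=
  Measurable.copy 'rV[R]_n (g_sigma_algebraType (@open 'rV[R]_n)).

Section borel_rV.
Context {R : realType}.

Lemma open_measurable_rV n (U : set 'rV[R]_n) : open U -> measurable U.
Proof. by move=> oU; apply: sub_sigma_algebra. Qed.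

Lemma closed_measurable_rV n (F : set 'rV[R]_n) : closed F -> measurable F.
Proof.
move=> cF; rewrite -[F]setCK; apply: measurableC.
by apply: open_measurable_rV; rewrite openC.
Qed.

Lemma compact_measurable_rV n (K : set 'rV[R]_n) : compact K -> measurable K.
Proof.
move=> cK; apply: closed_measurable_rV; exact: compact_closed.
Qed.

Lemma continuous_measurable_rV n (g : 'rV[R]_n -> R) :
  continuous g -> measurable_fun setT g.
Proof.
move=> cg; apply: (measurability _ (RGenOInfty.measurableE R)).
move=> _ [_ [x ->] <-]; rewrite setTI; apply: open_measurable_rV.
by apply: open_comp => //; exact: interval_open.
Qed.

Lemma measurable_fun_rV d (T : measurableType d) n (D : set T)
    (g : T -> 'rV[R]_n) :
  (forall i, measurable_fun D (fun t => g t 0 i)) -> measurable_fun D g.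
Proof.
move=> mg mD; apply: (measurability (@open 'rV[R]_n)) => // _ [U oU <-].
pose e (k : nat) : R := k.+1%:R^-1.
pose c (q : 'rV[rat]_n) : 'rV[R]_n := map_mx ratr q.
pose B (qk : 'rV[rat]_n * nat) := [set v : 'rV[R]_n |
  (forall i, ball (c qk.1 0 i) (e qk.2) (v 0 i)) /\
  (forall w : 'rV[R]_n,
     (forall i, ball (c qk.1 0 i) (e qk.2) (w 0 i)) -> U w)].
have -> : D `&` g @^-1` U = \bigcup_qk (D `&` g @^-1` B qk).
  apply/seteqP; split=> [t [Dt Ugt]|t [qk _ [Dt [h1 h2]]]]; last first.
    by split=> //; exact: h2.
  have [r r0 rU] : exists2 r : R, 0 < r & ball (g t) r `<=` U.
    by apply/nbhs_ballP; move: oU; rewrite openE => /(_ _ Ugt).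
  have [k _ ke] : \forall k \near \oo, e k < r / 2.
    have r20 : 0 < r / 2 by rewrite divr_gt0.
    exact: near_infty_natSinv_lt (PosNum r20).
  have ek0 : 0 < e k by rewrite invr_gt0.
  have [q qP] : exists q : 'rV[rat]_n,
      forall i, ball (c q 0 i) (e k) (g t 0 i).
    have hq i : exists q : rat, ball (ratr q : R) (e k) (g t 0 i).
      have [q] := @rat_in_itvoo R (g t 0 i - e k) (g t 0 i + e k)
        ltac:(by rewrite ltrD2l gtrN).
      rewrite in_itv/= => qP; exists q.
      by rewrite /ball/= ltr_distl.
    exists (\row_i sval (cid (hq i))) => i.
    by rewrite !mxE; case: cid.
  exists (q, k) => //; split=> //; split=> //= w qw.
  apply: rU; split=> // a j; rewrite [a]ord1.
  apply: (@le_ball _ _ _ (e k + e k)).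
    by rewrite [leRHS]splitr lerD// ltW// ke//=.
  by apply: ball_triangle (qw j); apply: ball_sym.
apply: countable_bigcupT_measurable => // -[q k].
have [sU|nsU] := pselect (forall w : 'rV[R]_n,
    (forall i, ball (c q 0 i) (e k) (w 0 i)) -> U w); last first.
  rewrite (_ : _ `&` _ = set0)//; apply/seteqP; split=> // t [_ []].
  by move=> _ /nsU.
have -> : D `&` g @^-1` B (q, k) = D `&` \bigcap_(i in [set: 'I_n])
    (D `&` (fun t => g t 0 i) @^-1` ball (c q 0 i) (e k)).
  apply/seteqP; split=> [t [Dt [/= h _]]|t [Dt h]]; split=> //.
    by move=> i _; split=> //; exact: h.
  by split=> // i; have [] := h i Logic.I.
apply: measurableI => //; apply: fin_bigcap_measurable => // i _.
by apply: mg => //; apply: open_measurable; exact: ball_open.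
Qed.


Lemma measurable_coord_rV n (i : 'I_n) :
  measurable_fun setT (fun v : 'rV[R]_n => v 0 i).
Proof. by apply: continuous_measurable_rV; exact: coord_continuous. Qed.

End borel_rV.

Section lebesgue_rV.
Context {R : realType}.

Definition cons_rV n (tv : measurableTypeR R * 'rV[R]_n) : 'rV[R]_n.+1 :=
  \row_i oapp (tv.2 0) tv.1 (unlift 0 i).

Lemma cons_rV0 n tv : @cons_rV n tv 0 0 = tv.1.
Proof. by rewrite mxE unlift_none. Qed.

Lemma cons_rVS n tv i : @cons_rV n tv 0 (lift 0 i) = tv.2 0 i.
Proof. by rewrite mxE liftK. Qed.

Lemma measurable_cons_rV n : measurable_fun setT (@cons_rV n).
Proof.
apply: measurable_fun_rV => i.
have [->|] := eqVneq i 0.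
  by under eq_fun do rewrite cons_rV0; exact: measurable_fst.
case: (unliftP 0 i) => [j ->|->]; last by rewrite eqxx.
move=> _; under eq_fun do rewrite cons_rVS.
exact: (measurableT_comp (measurable_coord_rV j) measurable_snd).
Qed.

Section step.
Variables (n : nat) (m : {sigma_finite_measure set 'rV[R]_n -> \bar R}).

Definition lebesgue_cons : set 'rV[R]_n.+1 -> \bar R :=
  pushforward (lebesgue_measure \x m)%E (@cons_rV n).

Let lebesgue_cons0 : lebesgue_cons set0 = 0%E.
Proof. by rewrite /lebesgue_cons /pushforward preimage_set0 measure0. Qed.

Let lebesgue_cons_ge0 A : (0 <= lebesgue_cons A)%E.
Proof. by rewrite /lebesgue_cons /pushforward measure_ge0. Qed.

Let lebesgue_cons_sigma_additive : semi_sigma_additive lebesgue_cons.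
Proof.
move=> F mF tF mUF; rewrite /lebesgue_cons /pushforward preimage_bigcup.
have mpre A : measurable A -> measurable (@cons_rV n @^-1` A).
  by move=> mA; rewrite -[X in measurable X]setTI; exact: measurable_cons_rV.
apply: measure_semi_sigma_additive.
- by move=> k; exact: mpre.
- apply/trivIsetP => /= i j _ _ ij; rewrite -preimage_setI.
  by move/trivIsetP : tF => /(_ _ _ _ _ ij) ->//; rewrite preimage_set0.
- by rewrite -preimage_bigcup; exact: mpre.
Qed.

HB.instance Definition _ := isMeasure.Build _ _ _ lebesgue_cons
  lebesgue_cons0 lebesgue_cons_ge0 lebesgue_cons_sigma_additive.

Let lebesgue_cons_sigma_finite : sigma_finite setT lebesgue_cons.
Proof.
pose hd (v : 'rV[R]_n.+1) : R := v 0 0.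
pose tl (v : 'rV[R]_n.+1) : 'rV[R]_n := \row_i v 0 (lift 0 i).
have consE v : cons_rV (hd v, tl v) = v.
  apply/rowP => i; case: (unliftP 0 i) => [j ->|->].
    by rewrite cons_rVS mxE.
  by rewrite cons_rV0.
have hdE tv : hd (@cons_rV n tv) = tv.1 by exact: cons_rV0.
have tlE tv : tl (@cons_rV n tv) = tv.2.
  by apply/rowP => i; rewrite mxE cons_rVS.
have [F FT mF] : sigma_finite setT (lebesgue_measure \x m)%E.
  have /sigma_finiteP[F [TF ndF Foo]] := sigma_finiteT (@lebesgue_measure R).
  have /sigma_finiteP[G [TG ndG Goo]] := sigma_finiteT m.
  exists (fun k => F k `*` G k).
    rewrite -setXTT TF TG; apply/seteqP; split=> [[x y] [/= [i _ Fx] [j _ Gy]]|].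
      exists (maxn i j) => //; split=> /=.
        by move: x Fx; exact/subsetPset/ndF/leq_maxl.
      by move: y Gy; exact/subsetPset/ndG/leq_maxr.
    by move=> [x y] [i _ [/= Fx Gy]]; split; exists i.
  move=> k; have [mF Fk] := Foo k; have [mG Gk] := Goo k.
  split; first exact: measurableX.
  by rewrite product_measure1E// lte_mul_pinfty// ge0_fin_numE.
exists (fun k => (fun v => (hd v, tl v)) @^-1` F k).
  apply/seteqP; split=> // v _.
  have : setT (hd v, tl v) by [].
  by rewrite FT => -[k _ Fk]; exists k.
move=> k; have [mFk Fkoo] := mF k; split.
  rewrite -[X in measurable X]setTI.
  suff : measurable_fun setT (fun v => (hd v, tl v)) by exact.
  apply/measurable_fun_pairP; split; first exact: measurable_coord_rV.
  apply: measurable_fun_rV => i; rewrite /comp /=.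
  by under eq_fun do rewrite mxE; exact: measurable_coord_rV.
rewrite /lebesgue_cons /pushforward.
rewrite (_ : _ @^-1` _ = F k)//.
by apply/seteqP; split=> -[t v]/=; rewrite hdE tlE.
Qed.

HB.instance Definition _ := Measure_isSigmaFinite.Build _ _ _ lebesgue_cons
  lebesgue_cons_sigma_finite.

End step.

(* Lebesgue measure on the Borel sets of R^n, as the n-fold product of the
   one-dimensional Lebesgue measure; see [lebesgue_rV_box]. *)
Fixpoint lebesgue_rV (n : nat) :
    {sigma_finite_measure set 'rV[R]_n -> \bar R} :=
  if n is n'.+1 then lebesgue_cons (lebesgue_rV n') else \d_(0 : 'rV[R]_0).

Lemma lebesgue_rV_box n (A : 'I_n -> set (measurableTypeR R)) :
  (forall i, measurable (A i)) ->
  lebesgue_rV n [set v : 'rV[R]_n | forall i, A i (v 0 i)] =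
  (\prod_(i < n) lebesgue_measure (A i))%E.
Proof.
elim: n A => [|n IHn] A mA.
  by rewrite big_ord0 /= diracE mem_set// => -[].
rewrite big_ord_recl -IHn//= /lebesgue_cons /pushforward.
set B := [set v : 'rV[R]_n | _].
have mB : measurable B.
  rewrite (_ : B = \bigcap_(i in [set: 'I_n])
      ((fun v : 'rV[R]_n => v 0 i) @^-1` A (lift 0 i))).
    apply: fin_bigcap_measurable => // i _.
    rewrite -[X in measurable X]setTI.
    by apply: (measurable_coord_rV i) => //; exact: mA.
  by apply/seteqP; split=> v Bv i; [move=> _|]; apply: Bv.
rewrite -product_measure1E//; congr (_ _).
apply/seteqP; split=> [[t v] /= h|[t v] [/= At Bv] i].
  split=> /= [|i]; first by have := h 0; rewrite cons_rV0.
  by have := h (lift 0 i); rewrite cons_rVS.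
case: (unliftP 0 i) => [j ->|->]; first by rewrite cons_rVS; exact: Bv.
by rewrite cons_rV0.
Qed.

End lebesgue_rV.

Section graph_measure.
Context {R : realType} {p : nat}.

(* The point (x, y) of R^p: its first p - 1 coordinates are those of [x], the
   last one is [y]. *)
Definition graph_point (x : 'rV[R]_p.-1) (y : R) : 'rV[R]_p :=
  \row_(i < p) (if insub (i : nat) is Some j then x 0 j else y).

Lemma measurable_graph (X : set 'rV[R]_p.-1) (f : 'rV[R]_p.-1 -> R) :
  measurable_fun X f -> measurable_fun X (fun x => graph_point x (f x)).
Proof.
move=> mf; apply: measurable_fun_rV => i; under eq_fun do rewrite mxE.
case: insub => [j|//].
exact: (measurable_funS measurableT _ (measurable_coord_rV j)).
Qed.

(* [mX] and [mf] are there for the measure structure only. *)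
Definition graph_measure (X : set 'rV[R]_p.-1) (f : 'rV[R]_p.-1 -> R)
    (mX : measurable X) (mf : measurable_fun X f) : set 'rV[R]_p -> \bar R :=
  fun A => lebesgue_rV p.-1 [set x | X x /\ A (graph_point x (f x))].

Section measure.
Variables (X : set 'rV[R]_p.-1) (f : 'rV[R]_p.-1 -> R).
Variables (mX : measurable X) (mf : measurable_fun X f).

Let graph_measure0 : graph_measure mX mf set0 = 0%E.
Proof.
by rewrite /graph_measure (_ : mkset _ = set0) ?measure0// -subset0 => x [].
Qed.

Let graph_measure_ge0 A : (0 <= graph_measure mX mf A)%E.
Proof. by rewrite /graph_measure measure_ge0. Qed.

Let graph_measure_sigma_additive : semi_sigma_additive (graph_measure mX mf).
Proof.
have mpre A : measurable A ->
    measurable [set x | X x /\ A (graph_point x (f x))].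
  exact: (measurable_graph mf mX).
move=> F mF tF mUF; rewrite /graph_measure.
rewrite (_ : [set x | _ /\ (\bigcup_n F n) _] =
    \bigcup_n [set x | X x /\ F n (graph_point x (f x))]); last first.
  by apply/seteqP; split=> [x [Xx [i _ Fx]]|x [i _ [Xx Fx]]];
    [exists i|split=> //; exists i].
apply: measure_semi_sigma_additive.
- by move=> k; exact: mpre.
- apply/trivIsetP => /= i j _ _ ij; rewrite -subset0 => x [[_ Fi] [_ Fj]].
  move/trivIsetP : tF => /(_ _ _ Logic.I Logic.I ij).
  by rewrite -subset0 => /(_ (graph_point x (f x))); exact.
- rewrite (_ : \bigcup_n _ = [set x | X x /\ (\bigcup_n F n) (graph_point x (f x))]).
    exact: mpre.
  by apply/seteqP; split=> [x [i _ [Xx Fx]]|x [Xx [i _ Fx]]];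
    [split=> //; exists i|exists i].
Qed.

HB.instance Definition _ := isMeasure.Build _ _ _ (graph_measure mX mf)
  graph_measure0 graph_measure_ge0 graph_measure_sigma_additive.

End measure.

End graph_measure.

Section euclidean.
Context {R : realType} {n : nat}.
Implicit Types (u v z : 'rV[R]_n) (A : set 'rV[R]_n).

(* The canonical norm of ['rV[R]_n] is the sup norm; it induces the same
   topology, but the distances below are Euclidean. *)
Definition eucl_dist u v : R := Num.sqrt (\sum_(i < n) (u 0 i - v 0 i) ^+ 2).

Definition eucl_diam A : R := sup [set eucl_dist uv.1 uv.2 | uv in A `*` A].

(* equal to [+oo] when [A] is empty *)
Definition eucl_setdist z A : \bar R := ereal_inf [set (eucl_dist z u)%:E | u in A].

(* This intersection has itself a [mu]-null complement, as R^n is second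
   countable: it is the smallest closed set whose complement is [mu]-null. *)
Definition msupport (mu : set 'rV[R]_n -> \bar R) : set 'rV[R]_n :=
  \bigcap_(F in [set F | closed F /\ mu (~` F) = 0%E]) F.

End euclidean.

(* The notations of [mpoly] clash with those of [all_analysis]. *)
Import -(notations) mpoly.

Section christoffel_darboux.
Context {R : realType} {p : nat}.

Definition peval (P : mpoly.mpoly p R) (z : 'rV[R]_p) : R :=
  mpoly.meval (z 0) P.

(* [mpoly.msize P] is the total degree of [P] plus one. *)
Definition orthonormal_polys (mu0 : {measure set 'rV[R]_p -> \bar R}) (d N : nat)
    (b : 'I_N -> mpoly.mpoly p R) : Prop :=
  (forall i, (mpoly.msize (b i) <= d.+1)%N) /\
  (forall i j, \int[mu0]_z (peval (b i) z * peval (b j) z)%:E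
               = (i == j)%:R%:E)%E.

Definition polyvec N (b : 'I_N -> mpoly.mpoly p R) (z : 'rV[R]_p) : 'cV[R]_N :=
  \col_i peval (b i) z.

Definition moment_mx (mu : {measure set 'rV[R]_p -> \bar R}) N
    (b : 'I_N -> mpoly.mpoly p R) : 'M[R]_N :=
  \matrix_(i, j) (\int[mu]_z (polyvec b z *m (polyvec b z)^T) i j)%R.

Definition cd_poly (mu : {measure set 'rV[R]_p -> \bar R}) (beta : R) N
    (b : 'I_N -> mpoly.mpoly p R) (z : 'rV[R]_p) : R :=
  ((polyvec b z)^T *m invmx (moment_mx mu b + beta%:M) *m polyvec b z) 0 0.

End christoffel_darboux.

(* Main.v *)
Require Import Defs.
From HB Require Import structures.
From mathcomp Require Import all_boot all_order all_algebra.
From mathcomp Require Import all_classical all_reals all_analysis.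
From mathcomp Require Import zify ring lra.
From mathcomp Require Import measurable_realfun.
From mathcomp Require mpoly.
Import Order.TTheory GRing.Theory Num.Theory.
Import numFieldNormedType.Exports.
Local Open Scope classical_set_scope.
Local Open Scope ring_scope.

(** Write q for the Christoffel-Darboux polynomial of mu + beta mu0 in degree d
    and N = C(p + d, d). As q_alpha lies between (1 - alpha) q and
    (1 + alpha) q, both claims reduce to bounds on q.

    Upper bound, for (i). The integral of q against mu is
    tr((M + beta I)^-1 M) <= N ([Rintegral_cd_poly_le]). By Markov's inequality
    the set where q >= gamma / (1 + alpha) has mu-measure at most
    N (1 + alpha) / gamma, and N <= d^p e^(p^2/d) e^p / p^p ([binomial_le]).

    Lower bound, for (ii). The polynomials b_i span all polynomials of degree at
    most d, because they are independent and their number is the dimension of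
    that space ([mpoly_span]). By the Cauchy-Schwarz inequality for the form
    M + beta I, q(z) is therefore at least 1 / (int P^2 dmu + beta int P^2 dmu0)
    for every polynomial P of degree at most d with P(z) = 1 ([cd_poly_ge]).
    If z is farther than delta0 / (sqrt d - 1) from the support of mu, then a
    needle polynomial centred at z, built from a Chebyshev polynomial
    ([needle_polynomial]), has P^2 <= 2^(3 - sqrt d) on the support of mu and
    P^2 <= 1 on the support of mu0 ([far_polynomial]). Hence
    q(z) >= 2^(sqrt d) / (8 (m + m0)), and 2^(sqrt d) is at least
    e^(2r) d^r / (3r)^(2r) ([exp2_sqrt_ge]), so z cannot lie in S_d.

    The measure theory behind these estimates is that a measure on R^n is
    carried by its support ([msupport_conull]), that mu and mu0 are finite, and
    that their supports are compact. *)

Set Implicit Arguments.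
Unset Strict Implicit.
Unset Printing Implicit Defensive.

(** * Chebyshev polynomials *)

Section Chebyshev.
Variable A : comNzRingType.
Implicit Types (x s : A) (n : nat).

(** The pair of Chebyshev polynomials (T_n, U_(n-1)) at [x]. This coupled
    recursion, over any commutative ring, serves both for real numbers and for
    polynomials in several variables, and [cheb_morph] relates the two. *)
Fixpoint cheb x n : A * A :=
  if n is n'.+1 then
    let: (t, u) := cheb x n' in (x * t + (x ^+ 2 - 1) * u, x * u + t)
  else (1, 0).

Lemma chebS x n : cheb x n.+1 =
  (x * (cheb x n).1 + (x ^+ 2 - 1) * (cheb x n).2,
   x * (cheb x n).2 + (cheb x n).1).
Proof. by rewrite /=; case: (cheb x n). Qed.

(** Pell's equation replaces the trigonometric description of T_n: it bounds
    T_n on [-1, 1] and compares T_n with U_(n-1) beyond 1. *)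
Lemma cheb_pell x n : (cheb x n).1 ^+ 2 - (x ^+ 2 - 1) * (cheb x n).2 ^+ 2 = 1.
Proof.
elim: n => [|n IHn]; first by rewrite /= expr1n expr0n /= mulr0 subr0.
by rewrite chebS /=; apply: etrans IHn; ring.
Qed.

(** Pell's equation says that T_n + s U_(n-1) has norm 1; it is the [n]-th power
    of the fundamental unit x + s. *)
Lemma cheb_pow x s n : s ^+ 2 = x ^+ 2 - 1 ->
  (cheb x n).1 + s * (cheb x n).2 = (x + s) ^+ n.
Proof.
move=> sE; elim: n => [|n IHn]; first by rewrite /= mulr0 addr0.
by rewrite chebS [RHS]exprS -IHn /= -sE; ring.
Qed.
End Chebyshev.

Lemma cheb_morph (A B : comNzRingType) (h : {rmorphism A -> B}) (x : A) n :
  cheb (h x) n = (h (cheb x n).1, h (cheb x n).2).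
Proof.
elim: n => [|n IHn]; first by rewrite /= rmorph1 rmorph0.
by rewrite !chebS IHn /= !rmorphD /= !rmorphM /= rmorphB rmorphXn rmorph1.
Qed.

Section ChebyshevReal.
Variable R : realType.
Implicit Types (x y : R) (n : nat).

Lemma cheb_le1 x n : `|x| <= 1 -> `|(cheb x n).1| <= 1.
Proof.
have sqrE (y : R) : (`|y| <= 1) = (y ^+ 2 <= 1).
  by rewrite -[in RHS]real_normK ?num_real // expr_le1.
rewrite !sqrE => x1; have := cheb_pell x n.
have := mulr_ge0 (_ : 0 <= 1 - x ^+ 2) (sqr_ge0 (cheb x n).2).
rewrite subr_ge0 => /(_ x1); lra.
Qed.

Lemma cheb_ge0 x n : 1 <= x -> 0 <= (cheb x n).1 /\ 0 <= (cheb x n).2.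
Proof.
move=> x1; elim: n => [|n [t0 u0]]; first by rewrite ler01 lexx.
have x0 : 0 <= x by lra.
have s0 : 0 <= x ^+ 2 - 1 by rewrite subr_ge0 exprn_ege1.
by rewrite chebS /= !addr_ge0 ?mulr_ge0.
Qed.

Lemma cheb_mono x y n : 1 <= x -> x <= y ->
  (cheb x n).1 <= (cheb y n).1 /\ (cheb x n).2 <= (cheb y n).2.
Proof.
move=> x1 xy; elim: n => [|n [tt uu]]; first by rewrite !lexx.
have x0 : 0 <= x by lra.
have [t0 u0] := cheb_ge0 n x1.
have s0 : 0 <= x ^+ 2 - 1 by rewrite subr_ge0 exprn_ege1.
have ss : x ^+ 2 - 1 <= y ^+ 2 - 1 by rewrite lerD2r lerXn2r ?nnegrE //; lra.
by rewrite !chebS /= !lerD // ?ler_pM.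
Qed.

(** The chord of the convex function 2^t between 0 and 1 is 1 + t. *)
Lemma exp2_le_1D (t : R) : 0 <= t <= 1 -> 2 `^ t <= 1 + t.
Proof.
move=> /andP[t0 t1].
have := convex_expR (Itv01 t0 t1) (ln 2 : R^o) (0 : R^o).
rewrite !convRE /= mulr0 addr0 expR0 lnK ?posrE // /powR pnatr_eq0 /=.
by rewrite /unstable.onem; lra.
Qed.

(** With x = 1 + t^2 and s^2 = x^2 - 1, Pell's equation gives s U <= T, so that
    2 T >= T + s U = (x + s)^n; and x + s >= 1 + t >= 2^t because s >= t. *)
Lemma cheb_lower (t : R) n : 0 <= t <= 1 ->
  2 `^ (t * n%:R) <= 2 * (cheb (1 + t ^+ 2) n).1.
Proof.
move=> t01; have /andP[t0 t1] := t01.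
pose x := 1 + t ^+ 2; pose s := Num.sqrt (x ^+ 2 - 1).
have x1 : 1 <= x by rewrite lerDl sqr_ge0.
have sE : s ^+ 2 = x ^+ 2 - 1 by rewrite sqr_sqrtr // subr_ge0 exprn_ege1.
have ts : t <= s.
  rewrite -[leLHS]ger0_norm // -sqrtr_sqr ler_sqrt.
    by rewrite /x; have := sqr_ge0 t; nra.
  by rewrite subr_ge0 exprn_ege1.
have [T0 U0] := cheb_ge0 n x1.
have sU : s * (cheb x n).2 <= (cheb x n).1.
  rewrite -(@ler_pXn2r _ 2) ?nnegrE ?mulr_ge0 ?sqrtr_ge0 //.
  by rewrite exprMn sE; have := cheb_pell x n; lra.
apply: (@le_trans _ _ ((x + s) ^+ n)).
  rewrite powRrM powR_mulrn ?powR_ge0 // lerXn2r ?nnegrE ?powR_ge0 //; first lra.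
  apply: (le_trans (exp2_le_1D t01)); rewrite /x; have := sqr_ge0 t; lra.
by rewrite -(cheb_pow n sE); lra.
Qed.

(** Obtained from e^(1/15) <= 15/14 and (15/14)^10 < 2. This is
    the bound on ln 2 that the constant 3 of (3r)^(2r) calls for. *)
Lemma ln2_gt : 2 / 3 < ln 2 :> R.
Proof.
rewrite -ltr_expR lnK ?posrE //.
have e10 : (expR (2 / 3 / 10) : R) <= 15 / 14.
  have := expR_ge1Dx (- (2 / 3 / 10) : R).
  by rewrite expRN -[X in _ <= X -> _]div1r ler_pdivlMr ?expR_gt0 //; lra.
have -> : (2 / 3 : R) = 10%:R * (2 / 3 / 10) by field.
rewrite expRM_natl; apply: (@le_lt_trans _ _ ((15 / 14) ^+ 10)).
  by rewrite lerXn2r ?nnegrE ?expR_ge0 //; lra.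
by lra.
Qed.
End ChebyshevReal.

(** * Positive definite quadratic forms *)

Section QuadraticForm.
Variables (R : realFieldType) (N : nat).
Implicit Types (A : 'M[R]_N) (c v : 'cV[R]_N).

Definition qform A c : R := (c^T *m A *m c) 0 0.

Lemma qform_tr A c : qform A^T c = qform A c.
Proof.
rewrite /qform; have -> : c^T *m A^T *m c = (c^T *m A *m c)^T.
  by rewrite !trmx_mul trmxK mulmxA.
by rewrite mxE.
Qed.

Lemma qform_unitmx A : (forall c, c != 0 -> 0 < qform A c) -> A \in unitmx.
Proof.
move=> pos; rewrite -row_free_unit; apply: inj_row_free => v vA.
apply: contraTeq isT => v0; have := pos v^T.
rewrite -(inj_eq trmx_inj) trmxK trmx0 => /(_ v0).
by rewrite /qform trmxK vA mul0mx mxE ltxx.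
Qed.

Lemma qform_invmx_ge0 A v : A \in unitmx -> (forall c, 0 <= qform A c) ->
  0 <= qform (invmx A) v.
Proof.
move=> uA pos; have := pos (invmx A *m v); rewrite -qform_tr /qform.
by rewrite -trmx_mul (mulmxA A) mulmxV // mul1mx mulmxA.
Qed.

(** The Cauchy-Schwarz inequality (c^T v)^2 <= (c^T A c) (v^T A^-1 v) for a
    positive definite matrix, where c^T v = 1. It follows from positivity of the
    form at c - B A^-1 v, without dividing by the form at [c]. *)
Lemma qform_invmx_ge A c v (B : R) : A^T = A -> A \in unitmx ->
  (forall c, 0 <= qform A c) ->
  (c^T *m v) 0 0 = 1 -> 0 < B -> qform A c <= B -> B^-1 <= qform (invmx A) v.
Proof.
move=> sA uA pos cv1 B0 cB.
pose w := invmx A *m v.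
have Aw : A *m w = v by rewrite mulmxA mulmxV // mul1mx.
have wA : w^T *m A = v^T by rewrite -Aw -[in LHS]sA -trmx_mul.
have vc1 : (v^T *m c) 0 0 = 1 by rewrite -cv1 -[in RHS](trmxK v) -trmx_mul [RHS]mxE.
have qE : qform (invmx A) v = (v^T *m w) 0 0 by rewrite /qform mulmxA.
have := pos (c - B *: w).
have -> : qform A (c - B *: w) = qform A c - 2 * B + B ^+ 2 * qform (invmx A) v.
  have -> : qform A (c - B *: w) = ((c^T - B *: w^T) *m A *m (c - B *: w)) 0 0.
    by rewrite /qform [(_ - _)^T]raddfB /= [(_ *: _)^T]linearZ.
  rewrite qE /qform !mulmxBl !mulmxBr -!scalemxAl -!scalemxAr.
  rewrite wA -!(mulmxA _ A w) Aw !mxE.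
  have := vc1; have := cv1; rewrite !mxE => -> ->; ring.
rewrite -div1r ler_pdivrMr //; nra.
Qed.

Lemma mxtrace_invmx_ge0 A : A \in unitmx -> (forall c, 0 <= qform A c) ->
  0 <= \tr (invmx A).
Proof.
move=> uA pos; rewrite /mxtrace sumr_ge0 // => i _.
have := qform_invmx_ge0 (delta_mx i 0) uA pos.
by rewrite /qform trmx_delta -rowE -colE !mxE.
Qed.
End QuadraticForm.

(** * Polynomials of bounded degree *)

Section PolynomialSpan.
Import -(notations) mpoly.
Variable (R : fieldType).

(** Exponents of total degree at most [d] are partial ordered partitions of
    [d] into [p] parts. *)
Lemma card_bmultinom p d : (#|{: bmultinom p d.+1}| <= 'C(p + d, p))%N.
Proof.
rewrite -card_partial_ord_partitions.
pose h (m : bmultinom p d.+1) : p.-tuple 'I_d.+1 := [tuple inord (m i) | i < p].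
have mle (m : bmultinom p d.+1) i : (m i <= d)%N.
  by rewrite -ltnS (leq_ltn_trans _ (bmdeg m)) // mdegE (bigD1 i) //= leq_addr.
have hI : injective h.
  move=> m1 m2 e; apply/val_inj/mnmP => i; have := congr1 (fun t => tnth t i) e.
  by rewrite !tnth_mktuple => /(congr1 val); rewrite /= !inordK ?ltnS.
rewrite -(card_imset _ hI); apply: subset_leq_card.
apply/fintype.subsetP => _ /imsetP[m _ ->].
rewrite inE big_tuple -ltnS (leq_ltn_trans _ (bmdeg m)) // mdegE.
by apply: leq_sum => i _; rewrite tnth_mktuple inordK ?ltnS.
Qed.

(** The coefficient matrix of an independent family has full row rank. As it has
    no more columns than rows, by [card_bmultinom], it also has full column
    rank. *)
Lemma mpoly_span p d (b : 'I_('C(p + d, d)) -> mpoly p R) :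
  (forall i, (msize (b i) <= d.+1)%N) ->
  (forall c : 'rV[R]_('C(p + d, d)), \sum_i c 0 i *: b i = 0 -> c = 0) ->
  forall P : mpoly p R, (msize P <= d.+1)%N ->
  exists c : 'cV[R]_('C(p + d, d)), P = \sum_i c i 0 *: b i.
Proof.
move=> sb ind P sP.
pose N := 'C(p + d, d); pose M := #|{: bmultinom p d.+1}|.
pose row_of (Q : mpoly p R) : 'rV[R]_M := \row_j mcoeff (bmnm (enum_val j)) Q.
have row_of_inj Q1 Q2 : (msize Q1 <= d.+1)%N -> (msize Q2 <= d.+1)%N ->
    row_of Q1 = row_of Q2 -> Q1 = Q2.
  move=> s1 s2 /rowP e; apply/mpolyP => m.
  have [md|md] := ltnP (mdeg m) d.+1.
    have := e (enum_rank (BMultinom md)); rewrite !mxE enum_rankK; exact.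
  by rewrite !memN_msupp_eq0 // msize_mdeg_ge ?(leq_trans _ md).
pose B : 'M[R]_(N, M) := \matrix_i row_of (b i).
have sum_size (c : 'rV[R]_N) : (msize (\sum_i c 0 i *: b i) <= d.+1)%N.
  apply: leq_trans (mmeasure_sum _ _ _ _) _; apply/bigmax_leqP => i _.
  exact: leq_trans (msizeZ_le _ _) (sb i).
have mulB (c : 'rV[R]_N) : c *m B = row_of (\sum_i c 0 i *: b i).
  apply/rowP => j; rewrite !mxE linear_sum /=; apply: eq_bigr => i _.
  by rewrite !mxE linearZ.
have frB : row_free B.
  apply: inj_row_free => c; rewrite mulB => e; apply: ind.
  apply: row_of_inj; rewrite ?sum_size ?mmeasure0 // e.
  by apply/rowP => j; rewrite !mxE mcoeff0.
have fuB : row_full B.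
  rewrite /row_full eqn_leq rank_leq_col /= (eqP frB).
  by rewrite /N -(bin_sub (leq_addl p d)) addnK card_bmultinom.
have [c cE] := submxP (submx_full (row_of P) fuB).
exists c^T; apply: row_of_inj => //; rewrite ?cE ?mulB.
  by under eq_bigr do rewrite mxE; exact: sum_size.
by congr row_of; apply: eq_bigr => i _; rewrite mxE.
Qed.
End PolynomialSpan.

(** * Needle polynomials *)

Section Needle.
Import -(notations) mpoly.
Variable (R : realType) (p : nat).

Lemma msizeM_bound (P Q : mpoly p R) a b :
  (msize P <= a.+1)%N -> (msize Q <= b.+1)%N -> (msize (P * Q) <= (a + b).+1)%N.
Proof.
move=> sP sQ.
have [->|P0] := eqVneq P 0; first by rewrite mul0r mmeasure0.
have [->|Q0] := eqVneq Q 0; first by rewrite mulr0 mmeasure0.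
by rewrite msizeM // -subn1 leq_subLR add1n -addSn -addnS leq_add.
Qed.

Lemma msize_cheb (P : mpoly p R) n : (msize P <= 3)%N ->
  (msize (cheb P n).1 <= (2 * n).+1)%N.
Proof.
move=> sP; have sP2 : (msize (P ^+ 2 - 1) <= 5)%N.
  apply: leq_trans (mmeasureD_le _ _ _) _.
  by rewrite geq_max mmeasureN mmeasure1 expr2 (@msizeM_bound _ _ 2 2).
(* At n = 0 the second component is 0, of size 0: the predecessor is truncated. *)
suff : (msize (cheb P n).1 <= (2 * n).+1)%N /\ (msize (cheb P n).2 <= (2 * n).-1)%N.
  by case.
elim: n => [|n [IHt IHu]]; first by rewrite /= mmeasure1 mmeasure0.
have IHu' : (msize (cheb P n).2 <= (2 * n).-2.+1)%N by lia.
rewrite chebS /=; split.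
  apply: leq_trans (mmeasureD_le _ _ _) _; rewrite geq_max.
  apply/andP; split.
    by apply: leq_trans (msizeM_bound sP IHt) _; lia.
  have [->|n0] := posnP n; first by rewrite /= mulr0 mmeasure0.
  by apply: leq_trans (msizeM_bound sP2 IHu') _; lia.
apply: leq_trans (mmeasureD_le _ _ _) _; rewrite geq_max.
apply/andP; split; last by apply: leq_trans IHt _; lia.
have [->|n0] := posnP n; first by rewrite /= mulr0 mmeasure0.
by apply: leq_trans (msizeM_bound sP IHu') _; lia.
Qed.

(** A polynomial of degree at most 2n with value 1 at [z], bounded by 1 on the ball of
    radius [W] and exponentially small on the shell between [D] and [W]: with
    t = D / W, it is x |-> T_n(1 + t^2 - |x - z|^2 / W^2) / T_n(1 + t^2). On the
    shell the argument of T_n lies in [0, 1], where |T_n| <= 1, and the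
    denominator is large by [cheb_lower]; closer to [z] the argument is at most
    1 + t^2, and T_n is increasing beyond 1. *)
Lemma needle_polynomial (z : 'rV[R]_p) (D W : R) n : 0 <= D <= W -> 0 < W ->
  exists2 P : mpoly p R, (msize P <= (2 * n).+1)%N &
    [/\ peval P z = 1,
      forall x, eucl_dist z x <= W -> `|peval P x| <= 1 &
      forall x, D <= eucl_dist z x <= W -> `|peval P x| <= 2 / 2 `^ (D / W * n%:R)].
Proof.
move=> /andP[D0 DW] W0.
pose t := D / W.
have t01 : 0 <= t <= 1 by rewrite divr_ge0 ?(ltW W0) //= /t ler_pdivrMr // mul1r.
have x1 : 1 <= 1 + t ^+ 2 by rewrite lerDl sqr_ge0.
pose T := (cheb (1 + t ^+ 2) n).1.
have Tlow : 2 `^ (t * n%:R) <= 2 * T := cheb_lower n t01.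
have T0 : 0 < T by have := powR_gt0 (t * n%:R) (ltr0Sn R 1); lra.
pose Q : mpoly p R := mpolyC p (1 + t ^+ 2) -
  mpolyC p (W ^- 2) * \sum_i (mpolyC p (z 0 i) - mpolyX R (mnm1 i)) ^+ 2.
have QE x : peval Q x = 1 + t ^+ 2 - (eucl_dist z x / W) ^+ 2.
  rewrite /peval mevalB mevalM !mevalC; congr (_ - _).
  rewrite exprMn sqr_sqrtr ?sumr_ge0 // => [|i _]; last exact: sqr_ge0.
  rewrite exprVn mulrC; congr (_ * _); rewrite raddf_sum; apply: eq_bigr => i _.
  by rewrite /= rmorphXn /= mevalB mevalC mevalXU.
have chebE x : peval (cheb Q n).1 x = (cheb (peval Q x) n).1.
  by rewrite /peval (cheb_morph (meval (x 0))).
exists (T^-1 *: (cheb Q n).1).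
  apply: leq_trans (msizeZ_le _ _) _; apply: msize_cheb.
  apply: leq_trans (mmeasureD_le _ _ _) _; rewrite geq_max mmeasureN.
  have sC c k : (msize (mpolyC p c : mpoly p R) <= k.+1)%N.
    by rewrite mmeasureC; case: (_ != _).
  rewrite sC /= (@msizeM_bound _ _ 0 2) ?sC //.
  apply: leq_trans (mmeasure_sum _ _ _ _) _; apply/bigmax_leqP => i _.
  have sl : (msize (mpolyC p (z 0%R i) - mpolyX R (mnm1 i)) <= 2)%N.
    apply: leq_trans (mmeasureD_le _ _ _) _; rewrite geq_max mmeasureN sC.
    by rewrite /= mmeasureX ltnS; exact: eq_leq (mdeg1 i).
  by rewrite expr2 (@msizeM_bound _ _ 1 1).
have PE x : peval (T^-1 *: (cheb Q n).1) x = T^-1 * (cheb (peval Q x) n).1.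
  by rewrite -chebE /peval mevalZ.
have dist2_le1 x : eucl_dist z x <= W -> (eucl_dist z x / W) ^+ 2 <= 1.
  move=> xW; rewrite expr_le1 // ?divr_ge0 ?sqrtr_ge0 ?(ltW W0) //.
  by rewrite ler_pdivrMr // mul1r.
split.
- rewrite PE QE /eucl_dist big1 => [|i _]; last by rewrite subrr expr0n.
  by rewrite sqrtr0 mul0r expr0n subr0 mulVf ?gt_eqF.
- move=> x xW; rewrite PE QE normrM normfV (gtr0_norm T0) mulrC.
  rewrite ler_pdivrMr // mul1r.
  have a0 := sqr_ge0 (eucl_dist z x / W).
  have a2 := dist2_le1 x xW.
  have [y1|/ltW y1] := leP (1 + t ^+ 2 - (eucl_dist z x / W) ^+ 2) 1.
    apply: (@le_trans _ _ 1).
      by apply: cheb_le1; have := sqr_ge0 t; rewrite ler_norml; lra.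
    rewrite -(@ler_pXn2r _ 2) ?nnegrE ?(ltW T0) // expr1n.
    have := cheb_pell (1 + t ^+ 2) n; rewrite -/T.
    have : 0 <= ((1 + t ^+ 2) ^+ 2 - 1) * (cheb (1 + t ^+ 2) n).2 ^+ 2.
      by rewrite mulr_ge0 ?sqr_ge0 // subr_ge0 exprn_ege1.
    lra.
  have [c0 _] := cheb_ge0 n y1.
  by rewrite ger0_norm //; apply: (cheb_mono n y1 _).1; lra.
move=> x /andP[Dx xW]; rewrite PE QE normrM normfV (gtr0_norm T0).
have a1 : t ^+ 2 <= (eucl_dist z x / W) ^+ 2.
  by rewrite lerXn2r ?nnegrE ?divr_ge0 ?sqrtr_ge0 ?(ltW W0) // ler_pM2r ?invr_gt0.
have a2 := dist2_le1 x xW.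
apply: (@le_trans _ _ T^-1).
  rewrite ler_piMr ?invr_ge0 ?(ltW T0) //; apply: cheb_le1.
  by have := sqr_ge0 t; rewrite ler_norml; lra.
have P0 := powR_gt0 (t * n%:R) (ltr0Sn R 1).
by rewrite -/t ler_pdivlMr // mulrC ler_pdivrMr.
Qed.
End Needle.

(** * Supports of measures *)

Section Support.
Variables (R : realType) (n : nat).
Implicit Types nu : {measure set 'rV[R]_n -> \bar R}.

Lemma closed_msupport (nu : set 'rV[R]_n -> \bar R) : closed (msupport nu).
Proof. by apply: closed_bigI => F []. Qed.

Lemma msupport_sub (nu : set 'rV[R]_n -> \bar R) (F : set 'rV[R]_n) :
  closed F -> nu (~` F) = 0%E -> msupport nu `<=` F.
Proof. by move=> cF nuF x; apply. Qed.

Lemma rational_ball (x : 'rV[R]_n) (r : R) : 0 < r ->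
  exists q : 'rV[rat]_n * nat,
    ball (map_mx ratr q.1 : 'rV[R]_n) q.2.+1%:R^-1 x /\
    ball (map_mx ratr q.1 : 'rV[R]_n) q.2.+1%:R^-1 `<=` ball x r.
Proof.
move=> r0; have r20 : 0 < r / 2 by rewrite divr_gt0.
have [k _ /(_ k (leqnn k)) ke] := near_infty_natSinv_lt (PosNum r20).
have e0 : 0 < k.+1%:R^-1 :> R by rewrite invr_gt0.
have hq i : exists q : rat, ball (ratr q : R) k.+1%:R^-1 (x 0 i).
  have [q] := @rat_in_itvoo R (x 0 i - k.+1%:R^-1) (x 0 i + k.+1%:R^-1)
    ltac:(by rewrite ltrD2l gtrN).
  by rewrite in_itv/= => qP; exists q; rewrite /ball/= ltr_distl.
exists (\row_i sval (cid (hq i)), k) => /=.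
have cx : ball (map_mx ratr (\row_i sval (cid (hq i))) : 'rV[R]_n) k.+1%:R^-1 x.
  by split=> // a j; rewrite [a]ord1 !mxE; case: cid.
split=> // y cy; apply: (@le_ball _ _ _ (k.+1%:R^-1 + k.+1%:R^-1)).
  by rewrite [leRHS]splitr lerD// ltW.
by apply: ball_triangle cy; apply: ball_sym.
Qed.

(** The complement of the support is covered by null balls with rational centre
    and radius 1 / (k + 1), and there are countably many of them. *)
Lemma msupport_conull nu : nu (~` msupport nu) = 0%E.
Proof.
have oS : open (~` msupport nu) by rewrite openC; exact: closed_msupport.
apply/negligibleP; first exact: open_measurable_rV.
pose B (q : 'rV[rat]_n * nat) : set 'rV[R]_n :=
  ball (map_mx ratr q.1 : 'rV[R]_n) q.2.+1%:R^-1.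
have mB q : measurable (B q) by apply: open_measurable_rV; exact: ball_open.
pose F k : set 'rV[R]_n := if unpickle k is Some q then
  (if nu (B q) == 0%E then B q else set0) else set0.
have nF : nu.-negligible (\bigcup_k F k).
  apply: negligible_bigcup => k; rewrite /F.
  case: unpickle => [q|]; last exact: negligible_set0.
  case: ifPn => [/eqP Bq|_]; last exact: negligible_set0.
  by apply/negligibleP.
apply: negligibleS nF.
move=> x; rewrite /msupport setC_bigcap => -[C [cC nuC] nCx].
have [r r0 rC] : exists2 r : R, 0 < r & ball x r `<=` ~` C.
  apply/nbhs_ballP; have : open (~` C) by rewrite openC.
  by rewrite openE => /(_ _ nCx).
have [q [qx qr]] := rational_ball x r0.
exists (pickle q) => //; rewrite /F pickleK -/(B q).
have -> : nu (B q) = 0%E.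
  apply: subset_measure0 nuC => //; last exact: subset_trans rC.
  by apply: open_measurable_rV; rewrite openC.
by rewrite eqxx.
Qed.
End Support.

Lemma msupport_measure_add (R : realType) n (mu nu : {measure set 'rV[R]_n -> \bar R}) :
  compact (msupport mu) -> compact (msupport nu) ->
  [/\ compact (msupport (measure_add mu nu)),
    msupport mu `<=` msupport (measure_add mu nu) &
    msupport nu `<=` msupport (measure_add mu nu)].
Proof.
move=> cmu cnu; split.
- apply: (subclosed_compact _ (compactU cmu cnu)); first exact: closed_msupport.
  apply: msupport_sub; first by apply: closedU; exact: closed_msupport.
  have nullS (la : {measure set 'rV[R]_n -> \bar R}) (B : set 'rV[R]_n) :
      closed B -> la (~` (msupport la `|` B)) = 0%E.
    move=> cB; apply: subset_measure0 (msupport_conull la).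
    - apply: open_measurable_rV; rewrite openC; apply: closedU => //.
      exact: closed_msupport.
    - by apply: open_measurable_rV; rewrite openC; exact: closed_msupport.
    - by apply: subsetC => x; left.
  rewrite measure_addE nullS ?add0e; last exact: closed_msupport.
  by rewrite setUC nullS //; exact: closed_msupport.
- move=> x Sx F [cF]; rewrite measure_addE => /eqP.
  by rewrite padde_eq0 // => /andP[/eqP muF _]; exact: Sx.
- move=> x Sx F [cF]; rewrite measure_addE => /eqP.
  by rewrite padde_eq0 // => /andP[_ /eqP muF]; exact: Sx.
Qed.

(** * Integration of continuous functions *)

Lemma continuous_mul_fun (T : topologicalType) (R : realType) (f g : T -> R) :
  continuous f -> continuous g -> continuous (fun x => f x * g x).
Proof. by move=> cf cg x; apply: cvgM; [exact: cf|exact: cg]. Qed.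

Lemma continuous_sum_fun (T : topologicalType) (R : realType) I (s : seq I) (P : pred I)
    (F : I -> T -> R) :
  (forall i, continuous (F i)) -> continuous (fun x => \sum_(i <- s | P i) F i x).
Proof.
move=> cF; elim: s => [|i s IHs] x.
  by under eq_fun do rewrite big_nil; exact: cvg_cst.
under eq_fun do rewrite big_cons; case: (P i); last exact: IHs.
by apply: cvgD; [exact: cF|exact: IHs].
Qed.

Lemma continuous_prod_fun (T : topologicalType) (R : realType) I (s : seq I) (P : pred I)
    (F : I -> T -> R) :
  (forall i, continuous (F i)) -> continuous (fun x => \prod_(i <- s | P i) F i x).
Proof.
move=> cF.
elim: s => [|i s IHs] x; first by under eq_fun do rewrite big_nil; exact: cvg_cst.
under eq_fun do rewrite big_cons; case: (P i); last exact: IHs.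
by apply: cvgM; [exact: cF|exact: IHs].
Qed.

Section PolynomialContinuity.
Import -(notations) mpoly.
Lemma continuous_peval (R : realType) p (P : mpoly p R) : continuous (peval P).
Proof.
rewrite /peval; under eq_fun do rewrite mevalE.
apply: continuous_sum_fun => m; apply: continuous_mul_fun.
  by move=> x; exact: cst_continuous.
apply: continuous_prod_fun => i y.
apply: (@continuous_comp _ _ _ (fun z : 'rV[R]_p => z 0 i) (fun t => t ^+ m i)).
  exact: coord_continuous.
exact: exprn_continuous.
Qed.
End PolynomialContinuity.

Section CompactSupport.
Variables (R : realType) (n : nat) (nu : {measure set 'rV[R]_n -> \bar R}).
Hypotheses (nu_fin : (nu setT < +oo)%E) (nu_cpt : compact (msupport nu)).
Implicit Types (g : 'rV[R]_n -> R).

Lemma measurable_msupport : measurable (msupport nu).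
Proof. by apply: closed_measurable_rV; exact: closed_msupport. Qed.

Lemma measurable_EFin g : continuous g -> measurable_fun setT (EFin \o g).
Proof. by move=> cg; apply/measurable_EFinP; exact: continuous_measurable_rV. Qed.

(** A continuous function is bounded on the compact support, and the rest of the
    space is null. *)
Lemma integrable_continuous g : continuous g -> nu.-integrable setT (EFin \o g).
Proof.
move=> cg.
have mS := measurable_msupport.
apply/(negligible_integrable (measurableC mS)) => //.
- exact: measurable_EFin.
- exact: msupport_conull.
rewrite setTD setCK; apply: measurable_bounded_integrable => //.
- by rewrite (le_lt_trans _ nu_fin)// le_measure ?inE.
- exact: measurable_funS (continuous_measurable_rV cg).
have : compact (g @` msupport nu).
  by apply: continuous_compact => //; apply: continuous_subspaceT.
move=> /compact_bounded[M [Mr hM]]; exists M; split => // x Mx y Sy.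
by apply: (hM x Mx); exists y.
Qed.

Lemma Rintegral_sum_continuous I (s : seq I) (F : I -> 'rV[R]_n -> R) :
  (forall i, continuous (F i)) ->
  \int[nu]_x (\sum_(i <- s) F i x) = \sum_(i <- s) \int[nu]_x F i x.
Proof.
move=> cF; rewrite /Rintegral sum_fine => [|i _]; last first.
  exact: integrable_fin_num (integrable_continuous (cF i)).
rewrite -integral_sum // => [|i]; last exact: integrable_continuous (cF i).
by congr fine; apply: eq_integral => x _; rewrite sumEFin.
Qed.

Lemma RintegralZ_continuous c g : continuous g ->
  \int[nu]_x (c * g x) = c * \int[nu]_x g x.
Proof. by move=> cg; rewrite RintegralZl //; exact: integrable_continuous. Qed.

Lemma Rintegral_le_msupport g c : continuous g ->
  (forall x, msupport nu x -> g x <= c) -> \int[nu]_x g x <= c * fine (nu setT).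
Proof.
move=> cg gc; have mS := measurable_msupport.
have nuS : nu setT = nu (msupport nu).
  have := measureU nu (measurableC mS) mS (setICl _).
  by rewrite setvU => ->; rewrite [X in (X + _)%E](msupport_conull nu) add0e.
rewrite /Rintegral (negligible_integral (measurableC mS)) //; last first.
- exact: msupport_conull.
- exact: integrable_continuous.
rewrite setTD setCK nuS -Rintegral_cst //; apply: le_Rintegral => //.
- exact: integrableS (integrable_continuous cg).
- apply: (integrableS measurableT mS (@subsetT _ _)).
  by apply: (@integrable_continuous (fun=> c)) => x; exact: cst_continuous.
Qed.
End CompactSupport.

(** * Moment matrices and Christoffel-Darboux polynomials *)

Section MomentMatrix.
Import -(notations) mpoly.
Variables (R : realType) (p N : nat) (nu : {measure set 'rV[R]_p -> \bar R}).
Hypotheses (nu_fin : (nu setT < +oo)%E) (nu_cpt : compact (msupport nu)).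
Variable b : 'I_N -> mpoly p R.
Implicit Types c : 'cV[R]_N.

Lemma peval_lincomb c z :
  peval (\sum_i c i 0 *: b i) z = (c^T *m polyvec b z) 0 0.
Proof.
rewrite /peval linear_sum !mxE; apply: eq_bigr => i _.
by rewrite !mxE linearZ.
Qed.

Lemma moment_mxE i j :
  moment_mx nu b i j = \int[nu]_z (peval (b i) z * peval (b j) z).
Proof.
rewrite mxE; apply: eq_Rintegral => z _.
by rewrite mxE big_ord1 !mxE.
Qed.

Lemma trmx_moment_mx : (moment_mx nu b)^T = moment_mx nu b.
Proof.
apply/matrixP => i j; rewrite mxE !moment_mxE.
by apply: eq_Rintegral => z _; rewrite mulrC.
Qed.

Lemma continuous_pevalM i j : continuous (fun z => peval (b i) z * peval (b j) z).
Proof. by apply: continuous_mul_fun; exact: continuous_peval. Qed.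

(** This holds since v^T A v = tr(A v v^T) and the moment matrix is the integral
    of v v^T. *)
Lemma mxtrace_moment (A : 'M[R]_N) :
  \int[nu]_z (qform A (polyvec b z)) = \tr (A *m moment_mx nu b).
Proof.
transitivity (\int[nu]_z \sum_i \sum_j (A i j * (peval (b j) z * peval (b i) z))).
  apply: eq_Rintegral => z _; rewrite /qform -mulmxA mxE; apply: eq_bigr => i _.
  rewrite !mxE big_distrr /=; apply: eq_bigr => j _.
  by rewrite !mxE; ring.
have cA i j : continuous (fun z => A i j * (peval (b j) z * peval (b i) z)).
  apply: continuous_mul_fun; last exact: continuous_pevalM.
  by move=> z; exact: cst_continuous.
rewrite Rintegral_sum_continuous // => [|i]; last exact: continuous_sum_fun.
apply: eq_bigr => i _; rewrite Rintegral_sum_continuous // mxE.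
apply: eq_bigr => j _.
by rewrite RintegralZ_continuous // ?moment_mxE //; exact: continuous_pevalM.
Qed.

Lemma qform_moment c :
  qform (moment_mx nu b) c = \int[nu]_z (peval (\sum_i c i 0 *: b i) z) ^+ 2.
Proof.
have -> : qform (moment_mx nu b) c = \tr ((c *m c^T) *m moment_mx nu b).
  by rewrite -mulmxA mxtrace_mulC /mxtrace big_ord1.
rewrite -mxtrace_moment; apply: eq_Rintegral => z _.
rewrite peval_lincomb /qform mulmxA -mulmxA mxE big_ord1 expr2; congr (_ * _).
by rewrite -[in LHS](trmxK (_ *m c)) trmx_mul trmxK mxE.
Qed.
End MomentMatrix.

Section ChristoffelDarboux.
Import -(notations) mpoly.
Variables (R : realType) (p d : nat) (mu mu0 : {measure set 'rV[R]_p -> \bar R}).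
Hypotheses (mu_fin : (mu setT < +oo)%E) (mu_cpt : compact (msupport mu)).
Hypotheses (mu0_fin : (mu0 setT < +oo)%E) (mu0_cpt : compact (msupport mu0)).
Variables (b : 'I_('C(p + d, d)) -> mpoly p R) (beta : R).
Hypotheses (hb : orthonormal_polys mu0 d b) (beta0 : 0 < beta).

Let M := moment_mx mu b + beta%:M.

Lemma moment_mx_orthonormal : moment_mx mu0 b = 1%:M.
Proof. by apply/matrixP => i j; rewrite moment_mxE /Rintegral hb.2 mxE. Qed.

(** The form c^T (M + beta I) c is the squared L^2(mu + beta mu0)-norm of the
    polynomial with coordinates [c], since [b] is orthonormal for [mu0]. *)
Lemma qform_regularized c : qform M c =
  \int[mu]_z (peval (\sum_i c i 0 *: b i) z) ^+ 2 +
  beta * \int[mu0]_z (peval (\sum_i c i 0 *: b i) z) ^+ 2.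
Proof.
rewrite -!qform_moment // moment_mx_orthonormal /M /qform.
rewrite mulmxDr mulmxDl -(scalemx1 _ beta) -scalemxAr -scalemxAl mxE; congr (_ + _).
by rewrite mxE.
Qed.

Lemma qform1E N (c : 'cV[R]_N) : qform 1%:M c = \sum_i c i 0 ^+ 2.
Proof. by rewrite /qform mulmx1 mxE; apply: eq_bigr => i _; rewrite mxE. Qed.

Lemma qform_regularized_ge0 c : 0 <= qform M c.
Proof.
by rewrite qform_regularized addr_ge0 ?mulr_ge0 ?(ltW beta0) //;
  apply: Rintegral_ge0 => z _; exact: sqr_ge0.
Qed.

Lemma regularized_unitmx : M \in unitmx.
Proof.
apply: qform_unitmx => c c0; rewrite qform_regularized ltr_wpDl //.
  by apply: Rintegral_ge0 => z _; exact: sqr_ge0.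
rewrite -qform_moment // moment_mx_orthonormal qform1E mulr_gt0 //.
have /existsP[i ci0] : [exists i, c i 0 != 0].
  apply: contraR c0; rewrite negb_exists => /forallP c0; apply/eqP/colP => i.
  by rewrite mxE; apply/eqP; rewrite -[_ == _]negbK c0.
rewrite (bigD1 i) //= ltr_wpDr ?sumr_ge0 // => [j _|]; first exact: sqr_ge0.
by rewrite lt_neqAle sqr_ge0 eq_sym sqrf_eq0 ci0.
Qed.

Lemma cd_poly_qform z : cd_poly mu beta b z = qform (invmx M) (polyvec b z).
Proof. by []. Qed.

Lemma cd_poly_ge0 z : 0 <= cd_poly mu beta b z.
Proof. exact: qform_invmx_ge0 regularized_unitmx qform_regularized_ge0. Qed.

(** An orthonormal family is independent, and [b] has as many members as the
    space of polynomials of degree at most [d] has dimensions. *)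
Lemma orthonormal_span (P : mpoly p R) : (msize P <= d.+1)%N ->
  exists c : 'cV[R]_('C(p + d, d)), P = \sum_i c i 0 *: b i.
Proof.
apply: mpoly_span; first exact: hb.1.
move=> c c0; apply: trmx_inj; rewrite trmx0.
have : qform (moment_mx mu0 b) c^T = 0.
  rewrite qform_moment //; under eq_bigr do rewrite mxE.
  rewrite c0 /peval; under eq_Rintegral do rewrite meval0 expr0n.
  by rewrite Rintegral_cst // mul0r.
rewrite moment_mx_orthonormal qform1E => /eqP.
rewrite psumr_eq0 => [|i _]; last exact: sqr_ge0.
move=> /allP h; apply/colP => i; rewrite [RHS]mxE; apply/eqP.
by have := h i (mem_index_enum _); rewrite /= sqrf_eq0.
Qed.

(** Half of the extremal property of the Christoffel-Darboux polynomial: its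
    value at [z] is at least 1 / |P|^2 for every [P] with P(z) = 1. *)
Lemma cd_poly_ge (P : mpoly p R) z (B : R) : (msize P <= d.+1)%N ->
  peval P z = 1 -> 0 < B ->
  \int[mu]_x (peval P x) ^+ 2 + beta * \int[mu0]_x (peval P x) ^+ 2 <= B ->
  B^-1 <= cd_poly mu beta b z.
Proof.
move=> /orthonormal_span[c ->] Pz B0 intB; rewrite cd_poly_qform.
apply: (@qform_invmx_ge _ _ _ c) => //.
- by rewrite /M raddfD /= trmx_moment_mx tr_scalar_mx.
- exact: regularized_unitmx.
- exact: qform_regularized_ge0.
- by rewrite -peval_lincomb.
- by rewrite qform_regularized.
Qed.

Lemma continuous_cd_poly : continuous (cd_poly mu beta b).
Proof.
have -> : cd_poly mu beta b =
    (fun z => \sum_i (\sum_j peval (b j) z * invmx M j i) * peval (b i) z).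
  apply/funext => z; rewrite cd_poly_qform /qform mxE; apply: eq_bigr => i _.
  by rewrite !mxE; congr (_ * _); apply: eq_bigr => j _; rewrite !mxE.
apply: continuous_sum_fun => i; apply: continuous_mul_fun; last exact: continuous_peval.
apply: continuous_sum_fun => j; apply: continuous_mul_fun; first exact: continuous_peval.
by move=> z; exact: cst_continuous.
Qed.

(** The integral is tr((M + beta I)^-1 M) = N - beta tr((M + beta I)^-1), where
    N is the number of polynomials, and the last trace is nonnegative. *)
Lemma Rintegral_cd_poly_le : \int[mu]_z cd_poly mu beta b z <= ('C(p + d, d))%:R.
Proof.
have -> : \int[mu]_z cd_poly mu beta b z = \tr (invmx M *m moment_mx mu b).
  by rewrite -mxtrace_moment //; apply: eq_Rintegral => z _; rewrite cd_poly_qform.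
have -> : moment_mx mu b = M - beta%:M by rewrite addrK.
rewrite mulmxBr mulVmx ?regularized_unitmx // raddfB /= mxtrace1.
rewrite mul_mx_scalar mxtraceZ gerBl mulr_ge0 ?(ltW beta0) //.
exact: mxtrace_invmx_ge0 regularized_unitmx qform_regularized_ge0.
Qed.

Lemma cd_poly_markov (c : R) (S : set 'rV[R]_p) : 0 < c -> measurable S ->
  (forall z, S z -> c <= cd_poly mu beta b z) ->
  (mu S <= (('C(p + d, d))%:R / c)%:E)%E.
Proof.
move=> c0 mS cS.
have intq := integrable_continuous mu_fin mu_cpt continuous_cd_poly.
have muS : mu S \is a fin_num.
  rewrite ge0_fin_numE // (le_lt_trans _ mu_fin) // le_measure ?inE //.
rewrite -(fineK muS) lee_fin ler_pdivlMr // mulrC -Rintegral_cst //.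
apply: le_trans Rintegral_cd_poly_le.
have H : (\int[mu]_(z in S) c%:E <= \int[mu]_z (cd_poly mu beta b z)%:E)%E.
  apply: (@le_trans _ _ (\int[mu]_(z in S) (cd_poly mu beta b z)%:E)%E).
    apply: ge0_le_integral => //.
    - by move=> z _; rewrite lee_fin ltW.
    - exact: measurable_funS (measurable_EFin continuous_cd_poly).
  apply: ge0_subset_integral => //; first exact: measurable_EFin continuous_cd_poly.
  by move=> z _; rewrite lee_fin cd_poly_ge0.
rewrite /Rintegral fine_le // ?integral_cst ?fin_numM //.
exact: integrable_fin_num intq.
Qed.
End ChristoffelDarboux.

Section FiniteReference.
Variables (R : realType) (p : nat) (mu0 : {measure set 'rV[R]_p -> \bar R}).
Variable b : 'I_('C(p + 0, 0)) -> mpoly.mpoly p R.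

(** In degree 0 the family [b] is one constant [c], and c^2 mu0(R^p) = 1. *)
Lemma orthonormal_mass : orthonormal_polys mu0 0 b ->
  (mu0 setT < +oo)%E /\ 0 < fine (mu0 setT).
Proof.
move=> [sb ob].
have i : 'I_('C(p + 0, 0)) by rewrite bin0; exact: ord0.
have := ob i i; rewrite eqxx.
under eq_integral do rewrite /peval (mpoly.msize1_polyC (sb i)) mpoly.mevalC -expr2.
set c := mpoly.mcoeff _ _.
rewrite integral_cst // => e.
have c0 : c != 0.
  apply/eqP => c0; move: e; rewrite c0 expr0n mul0e => /eqP.
  by rewrite eqe eq_sym oner_eq0.
have c20 : 0 < c ^+ 2 by rewrite lt_neqAle sqr_ge0 eq_sym sqrf_eq0 c0.
have mu0_fin : (mu0 setT < +oo)%E.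
  rewrite ltey; apply/eqP => mu0oo; move: e; rewrite mu0oo gt0_muley ?lte_fin //.
have fn : mu0 setT \is a fin_num by rewrite ge0_fin_numE.
split=> //; move: e; rewrite -(fineK fn) -EFinM => -[e].
by rewrite -(pmulr_rgt0 _ c20) e.
Qed.
End FiniteReference.

(** * Euclidean distance and bounded sets *)

Section Euclidean.
Variables (R : realType) (n : nat).
Implicit Types (u v w z : 'rV[R]_n).

(** Lagrange's identity: the difference of the two sides is half the sum of the
    squares (a_i b_j - a_j b_i)^2. *)
Lemma cauchy_schwarz_sum (a b : 'I_n -> R) :
  (\sum_i a i * b i) ^+ 2 <= (\sum_i a i ^+ 2) * (\sum_i b i ^+ 2).
Proof.
rewrite expr2 !big_distrlr /=.
have H : 0 <= \sum_i \sum_j (a i * b j - a j * b i) ^+ 2.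
  by apply: sumr_ge0 => i _; apply: sumr_ge0 => j _; exact: sqr_ge0.
have E : \sum_i \sum_j (a i * b j - a j * b i) ^+ 2 =
    \sum_i \sum_j a i ^+ 2 * b j ^+ 2 + \sum_i \sum_j a j ^+ 2 * b i ^+ 2
    - 2 * \sum_i \sum_j a i * b i * (a j * b j).
  rewrite mulr_sumr -sumrN -!big_split /=; apply: eq_bigr => i _.
  rewrite mulr_sumr -sumrN -!big_split /=; apply: eq_bigr => j _; ring.
have S : \sum_i \sum_j a j ^+ 2 * b i ^+ 2 = \sum_i \sum_j a i ^+ 2 * b j ^+ 2.
  exact: exchange_big.
by move: H; rewrite E S; lra.
Qed.

Lemma eucl_dist_triangle v u w : eucl_dist u w <= eucl_dist u v + eucl_dist v w.
Proof.
have sum_ge0 (a : 'I_n -> R) : 0 <= \sum_i a i ^+ 2.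
  by apply: sumr_ge0 => i _; exact: sqr_ge0.
rewrite -(@ler_pXn2r _ 2) ?nnegrE ?addr_ge0 ?sqrtr_ge0 //.
rewrite sqrrD /eucl_dist !sqr_sqrtr //.
set a := fun i => u 0 i - v 0 i; set b := fun i => v 0 i - w 0 i.
have -> : \sum_(i < n) (u 0 i - w 0 i) ^+ 2 =
    \sum_i a i ^+ 2 + 2 * (\sum_i a i * b i) + \sum_i b i ^+ 2.
  by rewrite mulr_sumr -!big_split /=; apply: eq_bigr => i _; rewrite /a /b; ring.
rewrite lerD2r lerD2l mulr_natl ler_wMn2r // -sqrtrM //.
apply: (le_trans (ler_norm _)); rewrite -sqrtr_sqr ler_wsqrtr //.
exact: cauchy_schwarz_sum.
Qed.

Lemma bounded_coord (K : set 'rV[R]_n) : bounded_set K ->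
  exists2 M : R, 0 < M & forall x, K x -> forall i, `|x 0 i| <= M.
Proof.
move=> [M [_ KM]]; exists (`|M| + 1); first by rewrite ltr_wpDl.
move=> x Kx i; apply: (@le_trans _ _ `|x|).
  rewrite [leRHS]mx_normrE.
  exact: (le_bigmax _ (fun ij : 'I_1 * 'I_n => `|x ij.1 ij.2|) (0, i)).
apply: KM => //; rewrite (le_lt_trans (ler_norm M)) // ltrDl //.
Qed.

Lemma eucl_dist_le_diam (K : set 'rV[R]_n) u v : compact K ->
  K u -> K v -> eucl_dist u v <= eucl_diam K.
Proof.
move=> cK Ku Kv; have [M M0 KM] := bounded_coord (compact_bounded cK).
apply: ub_le_sup; last by exists (u, v).
exists (Num.sqrt (\sum_(i < n) (2 * M) ^+ 2)) => _ [[x y] [/= Kx Ky] <-].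
apply: ler_wsqrtr; apply: ler_sum => i _.
rewrite -real_normK ?num_real // lerXn2r ?nnegrE ?mulr_ge0 ?(ltW M0) //.
by apply: (le_trans (ler_normB _ _)); have := KM _ Kx i; have := KM _ Ky i; lra.
Qed.

Lemma compact_cube (M : R) : compact [set z : 'rV[R]_n | forall i, `|z 0 i| <= M].
Proof.
have -> : [set z : 'rV[R]_n | forall i, `|z 0 i| <= M] =
    [set z : 'rV[R]_n | forall i, (`[- M, M]%classic : set R) (z 0 i)].
  by apply/seteqP; split => z /= h i; have := h i; rewrite /= in_itv /= ler_norml.
by apply: (@rV_compact _ _ (fun=> `[- M, M]%classic)) => i; exact: segment_compact.
Qed.
End Euclidean.

(** * The graph measure *)

Section GraphMeasure.
Variables (R : realType) (p : nat).

Lemma lebesgue_rV_bounded n (A : set 'rV[R]_n) : measurable A -> bounded_set A ->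
  (lebesgue_rV n A < +oo)%E.
Proof.
move=> mA /bounded_coord[M M0 AM].
pose I : set (measurableTypeR R) := `[- M, M]%classic.
have mI : measurable I by exact: measurable_itv.
have cubeE : [set z : 'rV[R]_n | forall i, `|z 0 i| <= M] =
    [set v : 'rV[R]_n | forall i, I (v 0 i)].
  by apply/seteqP; split => z /= h i; have := h i; rewrite /I /= in_itv /= ler_norml.
apply: (@le_lt_trans _ _ (lebesgue_rV n [set z : 'rV[R]_n | forall i, `|z 0 i| <= M])).
  apply: le_measure; rewrite ?inE //.
  exact: compact_measurable_rV (@compact_cube R n M).
rewrite cubeE (@lebesgue_rV_box _ _ (fun=> I)) //.
suff fin_prod : (\prod_(i < n) lebesgue_measure I)%E \is a fin_num.
  by rewrite -(fineK fin_prod) ltry.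
elim/big_ind : _ => // [x y|i _]; first exact: fin_numM.
by rewrite /I lebesgue_measure_itv; case: ifP.
Qed.

Variables (X : set 'rV[R]_p.-1) (f : 'rV[R]_p.-1 -> R) (Y : set R).
Hypotheses (cX : compact X) (cY : compact Y) (fXY : forall x, X x -> Y (f x)).
Hypothesis mf : measurable_fun X f.
Let mX := compact_measurable_rV cX.

Lemma graph_measure_fin : (graph_measure mX mf setT < +oo)%E.
Proof.
rewrite /graph_measure; rewrite (_ : [set x | _] = X).
  exact: lebesgue_rV_bounded (compact_bounded cX).
by apply/seteqP; split => [x []|x Xx].
Qed.

Lemma graph_measure_compact_msupport : compact (msupport (graph_measure mX mf)).
Proof.
have [MX MX0 XM] := bounded_coord (compact_bounded cX).
have [MY' [_ YM']] := compact_bounded cY.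
pose MY := `|MY'| + 1.
have YM y : Y y -> `|y| <= MY.
  by move=> Yy; apply: YM' => //; rewrite (le_lt_trans (ler_norm MY')) // ltrDl.
pose M := Num.max MX MY.
apply: (subclosed_compact _ (@compact_cube R p M)).
  exact: closed_msupport.
apply: msupport_sub.
  by apply: compact_closed (@compact_cube R p M) => //.
rewrite /graph_measure (_ : [set x | _] = set0) ?measure0 //.
apply/seteqP; split => // x [Xx]; apply => i /=; rewrite mxE le_max.
case: insubP => [j _ _|_]; first by rewrite XM.
by rewrite [X in _ || X]YM ?orbT //; apply: fXY.
Qed.
End GraphMeasure.

(** * Numerical estimates *)

Section Numerics.
Variable R : realType.

Lemma expR_ge_linear (x : R) : expR 1 * x <= expR x.
Proof.
have -> : expR x = expR 1 * expR (x - 1) by rewrite -expRD addrC subrK.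
by rewrite ler_pM2l ?expR_gt0 //; have := expR_ge1Dx (x - 1); lra.
Qed.

(** Put s = sqrt d. Taking the 2r-th root, the claim is e s / (3r) <= e^x with
    x = s ln 2 / (2r). By e x <= e^x it is enough that s / (3r) <= x, that is
    2/3 <= ln 2. *)
Lemma exp2_sqrt_ge d r : (0 < r)%N ->
  expR (2 * r)%:R * d%:R ^+ r / (3 * r)%:R ^+ (2 * r) <= 2 `^ Num.sqrt d%:R :> R.
Proof.
move=> r0; pose s : R := Num.sqrt d%:R; pose x := s * ln 2 / (2 * r)%:R.
have r0R : 0 < r%:R :> R by rewrite ltr0n.
have s0 : 0 <= s by rewrite sqrtr_ge0.
have -> : 2 `^ Num.sqrt d%:R = expR x ^+ (2 * r).
  rewrite -expRM_natl /powR pnatr_eq0 /=; congr expR.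
  by rewrite /x mulrC [RHS]mulrC divfK 1?mulrC // pnatr_eq0 muln_eq0 -lt0n.
have -> : expR (2 * r)%:R * d%:R ^+ r / (3 * r)%:R ^+ (2 * r) =
    (expR 1 * (s / (3 * r)%:R)) ^+ (2 * r) :> R.
  rewrite -[(2 * r)%:R]mulr1 expRM_natl -(@sqr_sqrtr _ d%:R) // -exprM.
  by rewrite !exprMn exprVn mulrA.
rewrite lerXn2r ?nnegrE ?expR_ge0 ?mulr_ge0 ?expR_ge0 ?divr_ge0 //.
apply: le_trans (expR_ge_linear x); rewrite ler_pM2l ?expR_gt0 // /x.
have -> : s / (3 * r)%:R = s * (2 / 3) / (2 * r)%:R :> R.
  by rewrite !natrM; field; rewrite gt_eqF.
by rewrite ler_pM2r ?invr_gt0 ?ltr0n ?muln_gt0 // ler_wpM2l // ltW // ln2_gt.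
Qed.

Lemma ffact_le_expn n m : (n ^_ m <= n ^ m)%N.
Proof.
elim: m => [|m IHm]; first by rewrite ffactn0.
by rewrite ffactnSr expnSr leq_mul // leq_subr.
Qed.

(** C(p + d, p) <= (p + d)^p / p!, where (p + d)^p = d^p (1 + p/d)^p is at most
    d^p e^(p^2/d), and 1 / p! <= e^p / p^p by the series of e^p. *)
Lemma binomial_le p d : (0 < p)%N -> (0 < d)%N ->
  ('C(p + d, d))%:R <= d%:R ^+ p * expR ((p ^ 2)%:R / d%:R) * expR p%:R / p%:R ^+ p :> R.
Proof.
move=> p0 d0; have p0R : 0 < p%:R :> R by rewrite ltr0n.
have d0R : 0 < d%:R :> R by rewrite ltr0n.
have f0 : 0 < (p`!)%:R :> R by rewrite ltr0n fact_gt0.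
rewrite -(bin_sub (leq_addl p d)) addnK.
have binE : ('C(p + d, p))%:R <= (p + d)%:R ^+ p / (p`!)%:R :> R.
  by rewrite ler_pdivlMr // -natrM bin_ffact -natrX ler_nat ffact_le_expn.
apply: (le_trans binE); rewrite -mulrA; apply: ler_pM.
- exact: exprn_ge0.
- by rewrite invr_ge0 ltW.
- have -> : (p + d)%:R = d%:R * (1 + p%:R / d%:R) :> R.
    by rewrite natrD; field; rewrite gt_eqF.
  rewrite exprMn ler_pM2l ?exprn_gt0 //.
  have -> : (p ^ 2)%:R / d%:R = p%:R * (p%:R / d%:R) :> R by rewrite natrX; ring.
  by rewrite expRM_natl lerXn2r ?nnegrE ?expR_ge0 ?expR_ge1Dx // addr_ge0 // divr_ge0.
rewrite ler_pdivlMr ?exprn_gt0 // mulrC.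
have -> : p = p.-1.+1 by rewrite prednK.
have := @expR_ge1Dxn R p.-1.+1%:R p.-1 (ler0n _ _); lra.
Qed.
End Numerics.

(** * Points far from the support *)

Section FarFromSupport.
Import -(notations) mpoly.
Variables (R : realType) (p d : nat) (mu mu0 : {measure set 'rV[R]_p -> \bar R}).
Hypotheses (mu_fin : (mu setT < +oo)%E) (mu_cpt : compact (msupport mu)).
Hypotheses (mu0_fin : (mu0 setT < +oo)%E) (mu0_cpt : compact (msupport mu0)).
Variables (b : 'I_('C(p + d, d)) -> mpoly.mpoly p R).
Hypotheses (hb : orthonormal_polys mu0 d b) (d1 : (1 < d)%N).

Let s : R := Num.sqrt d%:R.
Let beta : R := 2 `^ (3 - s).
Let m := fine (mu setT).
Let m0 := fine (mu0 setT).
Let delta0 := eucl_diam (msupport (measure_add mu mu0)).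

Let s1 : 1 < s.
Proof. by rewrite -sqrtr1 ltr_sqrt ?ltr1n // ltr0n ltnW. Qed.

(** With h the integer part of d / 2, 2h >= d - 1, so the exponent 2 - 2 t h of
    the left side is at most 2 - (d - 1) / s = 2 - s + 1 / s <= 3 - s. *)
Lemma exp2_needle (t : R) : s^-1 < t ->
  (2 / 2 `^ (t * (d./2)%:R)) ^+ 2 <= beta.
Proof.
move=> st; have P0 := powR_gt0 (t * (d./2)%:R) (ltr0Sn R 1).
have s0 : 0 < s by exact: lt_trans s1.
have -> : (2 / 2 `^ (t * (d./2)%:R)) ^+ 2 = 2 `^ (2 - t * (2 * (d./2)%:R)) :> R.
  rewrite powRB ?pnatr_eq0 ?implybT // expr_div_n; congr (_ / _).
    by rewrite powR_mulrn.
  by rewrite -powR_mulrn ?powR_ge0 // -powRrM; congr (_ `^ _); ring.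
rewrite /beta ler_powR ?ler1n //.
have dE : d%:R = s ^+ 2 by rewrite sqr_sqrtr.
have half : d%:R - 1 <= 2 * (d./2)%:R :> R.
  rewrite -[X in _ - _ <= X]natrM lerBlDr natr1 ler_nat mul2n.
  by rewrite -[leqLHS]odd_double_half -add1n leq_add2r; case: odd.
have h1 : s - s^-1 = s^-1 * (s ^+ 2 - 1) by field; rewrite gt_eqF.
have h2 : s^-1 * (s ^+ 2 - 1) <= t * (2 * (d./2)%:R).
  rewrite -dE ler_pM ?invr_ge0 ?(ltW s0) ?(ltW st) //.
  by rewrite dE subr_ge0 exprn_ege1 ?ltW.
have h3 : s^-1 <= 1 by rewrite invf_le1 // ltW.
lra.
Qed.

(** Let [D] be the distance from [z] to the support of [mu]. Both supports lie
    within W = D + delta0 of [z], and D > delta0 / (sqrt d - 1) means exactly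
    that D / W > 1 / sqrt d, so the needle polynomial at [z] with radii [D] and
    [W] is small enough on the support of [mu]. When that support is empty, the
    constant 1 does. *)
Lemma far_polynomial z :
  ((delta0 / (s - 1))%:E < eucl_setdist z (msupport mu))%E ->
  exists P : mpoly.mpoly p R, [/\ (msize P <= d.+1)%N, peval P z = 1,
    forall x, msupport mu x -> (peval P x) ^+ 2 <= beta &
    forall x, msupport mu0 x -> (peval P x) ^+ 2 <= 1].
Proof.
move=> far.
have [cK muK mu0K] := msupport_measure_add mu_cpt mu0_cpt.
have s10 : 0 < s - 1 by rewrite subr_gt0.
have [[u0 Su0]|S0] := pselect (exists u, msupport mu u); last first.
  exists 1; rewrite mmeasure1 /peval meval1; split => //.
    by move=> x Sx; exfalso; apply: S0; exists x.
  by move=> x _; rewrite meval1 expr1n.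
have del0 : 0 <= delta0.
  apply: (le_trans _ (eucl_dist_le_diam cK (muK _ Su0) (muK _ Su0))).
  exact: sqrtr_ge0.
have distfin : eucl_setdist z (msupport mu) \is a fin_num.
  rewrite ge0_fin_numE; first last.
    by apply/ereal_infP => _ [u _ <-]; rewrite lee_fin sqrtr_ge0.
  apply: (@le_lt_trans _ _ (eucl_dist z u0)%:E); last by rewrite ltry.
  by apply: ereal_inf_lbound; exists u0.
move: far; set D := fine (eucl_setdist z (msupport mu)).
rewrite -(fineK distfin) -/D lte_fin => far.
have rho0 : 0 <= delta0 / (s - 1) by rewrite divr_ge0 // ltW.
have D0 : 0 < D by exact: le_lt_trans far.
have muD x : msupport mu x -> D <= eucl_dist z x.
  by move=> Sx; rewrite -lee_fin fineK //; apply: ereal_inf_lbound; exists x.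
have KW x : msupport (measure_add mu mu0) x -> eucl_dist z x <= D + delta0.
  move=> Kx; rewrite -lerBlDr -lee_fin fineK //; apply/ereal_infP => _ [u Su <-].
  rewrite lee_fin lerBlDr (le_trans (eucl_dist_triangle u _ _)) // lerD2l.
  by apply: eucl_dist_le_diam => //; exact: muK.
have W0 : 0 < D + delta0 by rewrite ltr_wpDr.
have st : s^-1 < D / (D + delta0).
  rewrite ltr_pdivlMr // mulrC ltr_pdivrMr ?(lt_trans _ s1) //.
  by move: far; rewrite ltr_pdivrMr //; lra.
have [|P sP [Pz P1 PD]] := @needle_polynomial R p z D (D + delta0) d./2 _ W0.
  by rewrite (ltW D0) lerDl.
exists P; split => //.
- apply: leq_trans sP _; rewrite ltnS mul2n.
  by rewrite -[leqRHS]odd_double_half leq_addl.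
- move=> x Sx; apply: le_trans (exp2_needle st).
  rewrite -[leLHS]real_normK ?num_real // lerXn2r ?nnegrE ?divr_ge0 ?powR_ge0 //.
  by apply: PD; rewrite muD //= KW //; exact: muK.
- move=> x Sx; rewrite -[leLHS]real_normK ?num_real // expr_le1 //.
  by apply: P1; apply: KW; exact: mu0K.
Qed.

Lemma cd_poly_far z : 0 < m0 ->
  ((delta0 / (s - 1))%:E < eucl_setdist z (msupport mu))%E ->
  (beta * (m + m0))^-1 <= cd_poly mu beta b z.
Proof.
move=> m00 /far_polynomial[P [sP Pz Pmu Pmu0]].
have beta0 : 0 < beta by exact: powR_gt0.
have m_ge0 : 0 <= m by exact: fine_ge0.
have cP : continuous (fun x => peval P x ^+ 2).
  by under eq_fun do rewrite expr2; apply: continuous_mul_fun; exact: continuous_peval.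
apply: (cd_poly_ge mu_fin mu_cpt mu0_fin mu0_cpt hb beta0 sP Pz).
  by rewrite mulr_gt0 // ltr_wpDl.
rewrite mulrDr lerD //; first exact: Rintegral_le_msupport.
by rewrite ler_pM2l // -[leRHS]mul1r; exact: Rintegral_le_msupport.
Qed.
End FarFromSupport.

(** * The approximation theorem *)

Theorem theorem5 (R : realType) (p : nat) (hp : (2 <= p)%N)
    (X : set 'rV[R]_p.-1) (cX : compact X) (XE : X = closure X°)
    (Y : set R) (cY : compact Y)
    (f : 'rV[R]_p.-1 -> R) (fXY : forall x, X x -> Y (f x))
    (mf : measurable_fun X f)
    (mu0 : {measure set 'rV[R]_p -> \bar R})
    (ac : mu0 `<< lebesgue_rV p) (cmu0 : compact (msupport mu0))
    (b : forall d : nat, 'I_('C(p + d, d)) -> mpoly.mpoly p R)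
    (hb : forall d, orthonormal_polys mu0 d (b d))
    (alpha : R) (halpha : 0 <= alpha < 1)
    (qa : nat -> 'rV[R]_p -> R) (cqa : forall d, continuous (qa d)) :
  let mu : {measure set 'rV[R]_p -> \bar R} :=
    graph_measure (compact_measurable_rV cX) mf in
  let m : R := fine (mu setT) in
  let m0 : R := fine (mu0 setT) in
  let delta0 : R := eucl_diam (msupport (measure_add mu mu0)) in
  let beta (d : nat) : R := 2 `^ (3 - Num.sqrt d%:R) in
  let q (d : nat) : 'rV[R]_p -> R := cd_poly mu (beta d) (b d) in
  (forall d z, `|1 - qa d z / q d z| <= alpha) ->
  forall r : nat, (p < r)%N ->
  let gamma (d : nat) : R :=
    (1 - alpha) / (8 * (m + m0)) *
    (expR (2 * r)%:R * d%:R ^+ r / (3 * r)%:R ^+ (2 * r)) in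
  let Sd (d : nat) : set 'rV[R]_p := [set z | qa d z < gamma d] in
  forall d : nat, (1 < d)%N ->
    (mu [set z | ~ Sd d z] <=
      ((1 + alpha) / (1 - alpha) *
       (8 * (m + m0) * (3 * r)%:R ^+ (2 * r) * expR ((p ^ 2)%:R / d%:R) /
        (p%:R ^+ p * expR ((2 * r)%:R - p%:R) * d%:R ^+ (r - p)))%R)%:E)%E
    /\
    (forall z, Sd d z ->
      (eucl_setdist z (msupport mu) <= (delta0 / (Num.sqrt d%:R - 1))%:E)%E).
Proof.
move=> mu m m0 delta0 beta q hq r pr gamma Sd d d1.
have mu_fin : (mu setT < +oo)%E by exact: graph_measure_fin.
have mu_cpt : compact (msupport mu) by exact: graph_measure_compact_msupport cY fXY _.
have [mu0_fin m0_gt0] := orthonormal_mass (hb 0%N).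
have m_ge0 : 0 <= m by exact: fine_ge0.
have mm0 : 0 < m + m0 by rewrite ltr_wpDl.
have beta0 : 0 < beta d by exact: powR_gt0.
have /andP[a0 a1] := halpha.
have d0 : 0 < d%:R :> R by rewrite ltr0n ltnW.
have p0 : (0 < p)%N by exact: ltnW.
have r0 : (0 < r)%N by exact: leq_ltn_trans pr.
have p0R : 0 < p%:R :> R by rewrite ltr0n.
(* A zero of q would make the hypothesis read 1 <= alpha, as x / 0 = 0. *)
have q_gt0 z : 0 < q d z.
  rewrite lt_neqAle (cd_poly_ge0 mu_fin mu_cpt mu0_fin cmu0 (hb d) beta0) andbT.
  rewrite eq_sym; apply/eqP => q0; have := hq d z.
  by rewrite q0 invr0 mulr0 subr0 normr1; lra.
have qa_bounds z : (1 - alpha) * q d z <= qa d z <= (1 + alpha) * q d z.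
  have := hq d z; rewrite distrC ler_distl => /andP[lo up].
  by rewrite -ler_pdivlMr // lo -ler_pdivrMr.
have gamma_gt0 : 0 < gamma d.
  rewrite /gamma mulr_gt0 ?divr_gt0 ?mulr_gt0 ?subr_gt0 ?expR_gt0 ?exprn_gt0 //.
  by rewrite ltr0n muln_gt0.
split; last first.
  (* At a point too far from the support of mu, q_alpha >= (1 - alpha) q >= gamma. *)
  move=> z Sz; rewrite leNgt; apply/negP => far; move: Sz; apply/negP.
  rewrite -leNgt; have /andP[+ _] := qa_bounds z; apply: le_trans.
  have cdf := cd_poly_far mu_fin mu_cpt mu0_fin cmu0 (hb d) d1 m0_gt0 far.
  rewrite /gamma -mulrA ler_pM2l ?subr_gt0 //; apply: le_trans cdf.
  have -> : (2 `^ (3 - Num.sqrt d%:R) * (m + m0))^-1 =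
      (8 * (m + m0))^-1 * 2 `^ Num.sqrt d%:R.
    rewrite powRB ?pnatr_eq0 ?implybT // powR_mulrn //.
    have := powR_gt0 (Num.sqrt d%:R) (ltr0Sn R 1); set u := _ `^ _ => u0.
    by field; rewrite !gt_eqF.
  by rewrite ler_pM2l ?invr_gt0 ?mulr_gt0 // exp2_sqrt_ge.
have mS : measurable [set z | ~ Sd d z].
  apply: measurableC; apply: open_measurable_rV.
  have -> : Sd d = qa d @^-1` [set x | x < gamma d] by [].
  by apply: open_comp (@open_lt R (gamma d)) => z _; exact: cqa.
have c0 : 0 < gamma d / (1 + alpha) by rewrite divr_gt0 // ltr_wpDr.
have mk := cd_poly_markov mu_fin mu_cpt mu0_fin cmu0 (hb d) beta0 c0 mS.
apply: le_trans (mk _) _.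
  move=> z /negP; rewrite -leNgt => Sz; rewrite ler_pdivrMr ?ltr_wpDr // mulrC.
  by have /andP[_] := qa_bounds z; exact: le_trans.
rewrite lee_fin.
have bin := @binomial_le R p d p0 (ltnW d1).
have a1_gt0 : 0 < 1 + alpha by rewrite ltr_wpDr.
set C := ('C(p + d, d))%:R : R in bin *; set E := expR (_ / _) in bin *.
have -> : expR ((2 * r)%:R - p%:R) = expR (2 * r)%:R / expR p%:R :> R.
  by rewrite expRD expRN.
have -> : C / (gamma d / (1 + alpha)) = (1 + alpha) / (1 - alpha) *
    (8 * (m + m0) * (3 * r)%:R ^+ (2 * r)) / (expR (2 * r)%:R * d%:R ^+ r) * C.
  rewrite /gamma; field.
  by rewrite !gt_eqF ?expR_gt0 ?exprn_gt0 ?subr_gt0 // ltr0n muln_gt0.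
have dr : d%:R ^+ r = d%:R ^+ (r - p) * d%:R ^+ p :> R.
  by rewrite -exprD subnK // ltnW.
have -> : (1 + alpha) / (1 - alpha) * (8 * (m + m0) * (3 * r)%:R ^+ (2 * r) * E /
      (p%:R ^+ p * (expR (2 * r)%:R / expR p%:R) * d%:R ^+ (r - p))) =
    (1 + alpha) / (1 - alpha) *
    (8 * (m + m0) * (3 * r)%:R ^+ (2 * r)) / (expR (2 * r)%:R * d%:R ^+ r) *
    (d%:R ^+ p * E * expR p%:R / p%:R ^+ p).
  rewrite dr; field.
  by rewrite !gt_eqF ?expR_gt0 ?exprn_gt0 ?subr_gt0.
apply: ler_wpM2l => //; apply: ltW.
by rewrite !(divr_gt0, mulr_gt0) ?exprn_gt0 ?expR_gt0 ?subr_gt0 // ltr0n muln_gt0.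
Qed.
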